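(* Let $v^{(\ell)}_j$ ($\ell \ge 0$, $0 \le j \le 2^{\ell+1}-1$) be the rational numbers defined by $v^{(0)}_0 = 1$, $v^{(0)}_1 = 1$, and, for $\ell \ge 1$, $$v^{(\ell)}_0 = 1,\quad v^{(\ell)}_1 = 2,\quad v^{(\ell)}_{2j} = -\frac{v^{(\ell-1)}_j}{v^{(\ell)}_{2j-1}},\quad v^{(\ell)}_{2j+1} = 1 + (-1)^j - v^{(\ell)}_{2j}\qquad (1 \le j \le 2^\ell - 1).$$ For $\ell \ge 0$ let $g_\ell(z) = \frac{1}{z}\prod_{h=0}^{\ell}(1 - z^{-2^h}) \in \mathbb{Q}(z)$. Then, for every $\ell \ge 0$, $$g_\ell(z) = \cfrac{v^{(\ell)}_0}{z+1 + \cfrac{v^{(\ell)}_1}{z-1 + \cfrac{v^{(\ell)}_2}{z+1 + \cfrac{\ddots}{\ddots + \cfrac{v^{(\ell)}_{2^{\ell+1}-1}}{z-1}}}}},$$ where the $j$-th denominator (for $j = 0, 1, \ldots, 2^{\ell+1}-1$) is $z+1$ if $j$ is even and $z-1$ if $j$ is odd. Moreover, for every $\ell \ge 0$, all the partial quotients $a_i(z) \in \mathbb{Q}[z]$ in the continued fraction expansion $g_\ell(z) = [0; a_1(z), \ldots, a_m(z)] = \cfrac{1}{a_1(z) + \cfrac{1}{\ddots + \cfrac{1}{a_m(z)}}}$ are polynomials of degree one. *)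

(* Defs.v *)
From mathcomp Require Import all_boot all_order all_algebra.
Set Implicit Arguments.
Unset Strict Implicit.
Unset Printing Implicit Defensive.
Import GRing.Theory.
Local Open Scope ring_scope.

(* One level of the recursion: from [u] = (v^(l-1)_j)_j to (v^(l)_j)_j. *)
Fixpoint vnext (u : nat -> rat) (k : nat) : rat :=
  match k with
  | 0 => 1
  | 1 => 2
  | k'.+1 => if odd k then 1 + (-1) ^+ k./2 - vnext u k'
             else - (u k./2 / vnext u k')
  end.

(* [v l j] is v^(l)_j; it is meaningful only for j <= 2 ^ l.+1 - 1. *)
Fixpoint v (l : nat) : nat -> rat :=
  if l is l'.+1 then vnext (v l') else fun=> 1.

Lemma v00 : v 0 0 = 1. Proof. by []. Qed.
Lemma v01 : v 0 1 = 1. Proof. by []. Qed.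
Lemma vS0 l : v l.+1 0 = 1. Proof. by []. Qed.
Lemma vS1 l : v l.+1 1 = 2. Proof. by []. Qed.

Lemma vS_even l j : (0 < j)%N ->
  v l.+1 (2 * j)%N = - (v l j / v l.+1 (2 * j - 1)%N).
Proof.
case: j => // j _; rewrite mul2n doubleS subn1 /=.
by rewrite odd_double /= doubleK.
Qed.

Lemma vS_odd l j : (0 < j)%N ->
  v l.+1 (2 * j + 1)%N = 1 + (-1) ^+ j - v l.+1 (2 * j)%N.
Proof.
case: j => // j _; rewrite mul2n addn1 doubleS /=.
by rewrite odd_double /= uphalf_double.
Qed.

Notation Qz := {fraction {poly rat}}.

Definition Qz_const (c : rat) : Qz := tofrac c%:P.

Definition z : Qz := tofrac 'X.

Definition g (l : nat) : Qz := z^-1 * \prod_(h < l.+1) (1 - z ^- (2 ^ h)).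

(* The finite continued fraction b_0 / (c_0 + b_1 / (c_1 + ... + b_n / c_n))
   attached to the list of pairs (b_i, c_i). *)
Definition gencf (F : fieldType) (s : seq (F * F)) : F :=
  foldr (fun bc t => bc.1 / (bc.2 + t)) 0 s.

Definition den (j : nat) : Qz := if odd j then z - 1 else z + 1.

(* f = [a0; a_1, ..., a_m] with a = (a_1, ..., a_m). As usual for continued
   fractions over Q[z], the a_i with i >= 1 are required to be nonconstant;
   the expansion is then unique and no denominator vanishes in [gencf]. *)
Definition cf_expansion (f : Qz) (a0 : {poly rat}) (a : seq {poly rat}) : Prop :=
  (forall p, p \in a -> (1 < size p)%N) /\
  f = tofrac a0 + gencf [seq (1, tofrac p) | p : {poly rat} <- a].

(* Main.v *)
Require Import Defs.
From mathcomp Require Import all_boot all_order all_algebra.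
From mathcomp Require Import zify ring.
Set Implicit Arguments.
Unset Strict Implicit.
Unset Printing Implicit Defensive.
Import GRing.Theory Num.Theory.
Local Open Scope ring_scope.

(** Nonvanishing: for j < 2^(l+1) the 2-adic valuation of v^(l)_j is
    [j = 1] - [j = 2^l] - [j = 2^l + 1], a pattern which the recursion
    reproduces from one level to the next.

    Identity: g_(l+1)(z) = (z - 1) g_l(z^2), and dropping every other convergent
    of the level l+1 fraction in z leaves z - 1 times the level l fraction in
    z^2.  Indeed, if t_i is the tail of the former starting at v^(l+1)_i and s_k
    the tail of the latter starting at v^(l)_k, then s_k = - t_(2k-1) t_(2k) for
    k >= 1, by induction on the length of the tails.

    Degrees: rescaling by the nonzero constants v^(l)_j turns this fraction into
    a regular one with linear partial quotients, and a regular expansion is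
    unique because all its tails have negative degree. *)

Local Notation "x %:F" := (tofrac x).

Definition has_padic_val (p : nat) (e : int) (x : rat) : Prop :=
  exists m n : int,
    [/\ coprimez p m, coprimez p n & x = m%:~R / n%:~R * p%:R ^ e].

Section PadicValuation.

Variable p : nat.
Hypothesis p_gt1 : (1 < p)%N.

Let p_neq0 : p%:R != 0 :> rat.
Proof. by rewrite pnatr_eq0 -lt0n ltnW. Qed.

Lemma coprimez_intr_neq0 (m : int) : coprimez p m -> m%:~R != 0 :> rat.
Proof.
rewrite intr_eq0; apply: contraTneq => ->.
by rewrite coprimezE /coprime gcdn0 gtn_eqF.
Qed.

Lemma has_padic_val_neq0 e x : has_padic_val p e x -> x != 0.
Proof.
case=> m [n [pm pn ->]].
by rewrite !mulf_neq0 ?invr_eq0 ?expfz_neq0 ?coprimez_intr_neq0.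
Qed.

Lemma has_padic_val1 : has_padic_val p 0 1.
Proof. by exists 1, 1; rewrite coprimezE coprimen1 expr0z divr1 mulr1. Qed.

Lemma has_padic_val_base : has_padic_val p 1 p%:R.
Proof. by exists 1, 1; rewrite coprimezE coprimen1 expr1z divr1 mul1r. Qed.

Lemma has_padic_valN e x : has_padic_val p e x -> has_padic_val p e (- x).
Proof.
case=> m [n [pm pn ->]]; exists (- m), n.
by rewrite coprimezN rmorphN !mulNr.
Qed.

Lemma has_padic_val_div e f x y :
  has_padic_val p e x -> has_padic_val p f y -> has_padic_val p (e - f) (x / y).
Proof.
case=> m [n [pm pn ->]] [m' [n' [pm' pn' ->]]].
exists (m * n'), (n * m'); rewrite !coprimezMr pm pn pm' pn'; split=> //.
by rewrite !rmorphM expfzDr // -invr_expz !invfM !invrK /=; ring.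
Qed.

Lemma has_padic_valMnDl e x (k : int) :
  e <= 0 -> has_padic_val p e x -> has_padic_val p e (k%:~R * p%:R + x).
Proof.
move=> e_le0; have [f ->] : exists f : nat, e = - f%:Z by exists `|e|%N; lia.
case=> m [n [pm pn ->]]; exists (k * n * p%:Z ^+ f * p%:Z + m), n.
split=> //; first by rewrite /coprimez gcdzMDl.
have n_neq0 := coprimez_intr_neq0 pn.
rewrite -invr_expz -exprnP rmorphD !rmorphM rmorphXn /= -!pmulrn.
by field; rewrite n_neq0 expf_neq0.
Qed.

End PadicValuation.

Definition nonconstant (R : nzSemiRingType) (p : {poly R}) : bool :=
  (1 < size p)%N.
Arguments nonconstant {R} p.

Lemma ltn_size_neq0 (R : nzSemiRingType) (p : {poly R}) k :
  (k < size p)%N -> p != 0.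
Proof. by rewrite -size_poly_gt0; exact: leq_ltn_trans. Qed.

Lemma ltn_size_mulr (R : idomainType) (p q r : {poly R}) :
  r != 0 -> (size p < size q)%N -> (size (p * r)%R < size (q * r)%R)%N.
Proof.
move=> r_neq0 ltpq; have q_neq0 := ltn_size_neq0 ltpq.
have [->|p_neq0] := eqVneq p 0.
  by rewrite mul0r size_poly0 size_poly_gt0 mulf_neq0.
by rewrite !size_mul //; move: r_neq0; rewrite -size_poly_gt0; lia.
Qed.

Lemma size_addr_sign (R : nzRingType) (p : {poly R}) j :
  nonconstant p -> size (p + (-1) ^+ j) = size p.
Proof.
move=> p_nc; rewrite size_polyDl // (leq_ltn_trans _ p_nc) //.
by rewrite -signr_odd; case: odd; rewrite ?size_polyN size_poly1.
Qed.

Lemma nonconstant_exp (R : idomainType) (p : {poly R}) n :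
  nonconstant p -> nonconstant (p ^+ n.+1).
Proof. by rewrite /nonconstant -!ltn_predRL size_exp muln_gt0 => ->. Qed.

Section ProperFractions.

Variable R : idomainType.
Implicit Types (p q : {poly R}) (x y : {fraction {poly R}}).

Definition proper_fraction x : Prop :=
  exists n d : {poly R}, (size n < size d)%N /\ x = n%:F / d%:F.

Lemma proper_fraction0 : proper_fraction 0.
Proof. by exists 0, 1; rewrite size_poly0 size_poly1 tofrac0 mul0r. Qed.

Lemma proper_fractionB x y :
  proper_fraction x -> proper_fraction y -> proper_fraction (x - y).
Proof.
case=> n [d [ltnd ->]] [n' [d' [ltnd' ->]]].
have [d_neq0 d'_neq0] := (ltn_size_neq0 ltnd, ltn_size_neq0 ltnd').
exists (n * d' - n' * d), (d * d'); split.
  rewrite (leq_ltn_trans (size_polyD _ _)) // size_polyN gtn_max.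
  by rewrite ltn_size_mulr //= (mulrC d) ltn_size_mulr.
by rewrite -mulNr addf_div ?tofrac_eq0 // tofracB !tofracM mulNr.
Qed.

Lemma proper_fraction_div b p x :
  nonconstant p -> proper_fraction x -> proper_fraction (b%:P%:F / (p%:F + x)).
Proof.
move=> p_nc [n [d [ltnd ->]]].
have [p_neq0 d_neq0] := (ltn_size_neq0 p_nc, ltn_size_neq0 ltnd).
exists (b%:P * d), (p * d + n); split.
  have ltd : (size d < size (p * d)%R)%N.
    by rewrite size_mul //; move: p_nc; rewrite /nonconstant; lia.
  rewrite size_polyDl ?(ltn_trans ltnd) //.
  by rewrite mul_polyC (leq_ltn_trans (size_scale_leq _ _)).
have dF_neq0 : d%:F != 0 by rewrite tofrac_eq0.
by rewrite tofracD !tofracM -{1}(mulfK dF_neq0 p%:F) -mulrDl invf_div mulrA.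
Qed.

Lemma proper_tofrac p : proper_fraction p%:F -> p = 0.
Proof.
case=> n [d [ltnd pE]]; have d_neq0 := ltn_size_neq0 ltnd.
have nE : n = p * d.
  by apply/eqP; rewrite -tofrac_eq tofracM pE mulfVK // tofrac_eq0.
apply: contraTeq ltnd => p_neq0; rewrite nE size_mul // -leqNgt.
by move: p_neq0; rewrite -size_poly_gt0; lia.
Qed.

Lemma tofracD_proper_inj p q x y :
    proper_fraction x -> proper_fraction y ->
  p%:F + x = q%:F + y -> p = q /\ x = y.
Proof.
move=> x_proper y_proper eq_pxqy.
have eq_pq : p = q.
  apply/eqP; rewrite -subr_eq0; apply/eqP/proper_tofrac.
  have -> : (p - q)%:F = y - x.
    by rewrite tofracB -[p%:F](addrK x) eq_pxqy; ring.
  exact: proper_fractionB.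
by split=> //; move: eq_pxqy; rewrite eq_pq => /addrI.
Qed.

Lemma tofracD_proper_neq0 p x :
  p != 0 -> proper_fraction x -> p%:F + x != 0.
Proof.
move=> p_neq0 x_proper; apply: contra_neq p_neq0 => px0.
have [] // := @tofracD_proper_inj p 0 x 0 x_proper proper_fraction0.
by rewrite px0 tofrac0 addr0.
Qed.

End ProperFractions.

Definition cf_tail (F : fieldType) (b c : nat -> F) (i n : nat) : F :=
  gencf [seq (b j, c j) | j <- iota i n].

Lemma cf_tailS (F : fieldType) (b c : nat -> F) i n :
  cf_tail b c i n.+1 = b i / (c i + cf_tail b c i.+1 n).
Proof. by []. Qed.

Section PolynomialContinuedFractions.

Variable R : idomainType.
Implicit Types (p : {poly R}) (a : seq {poly R}) (s : seq (R * {poly R})).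

Definition polycf s : {fraction {poly R}} :=
  gencf [seq (bp.1%:P%:F, bp.2%:F) | bp <- s].

Definition regular_cf a : {fraction {poly R}} :=
  gencf [seq (1, p%:F) | p <- a].

Lemma polycf_cons b p s : polycf ((b, p) :: s) = b%:P%:F / (p%:F + polycf s).
Proof. by []. Qed.

Lemma polycf_iota (b : nat -> R) (c : nat -> {poly R}) i n :
  polycf [seq (b j, c j) | j <- iota i n]
    = cf_tail (fun j => (b j)%:P%:F) (fun j => (c j)%:F) i n.
Proof. by rewrite /polycf -map_comp. Qed.

Lemma regular_cf_cons p a : regular_cf (p :: a) = (p%:F + regular_cf a)^-1.
Proof. exact: mul1r. Qed.

Lemma regular_cfE a : regular_cf a = polycf [seq (1, p) | p <- a].
Proof.
elim: a => //= p a IHa.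
by rewrite regular_cf_cons polycf_cons IHa tofrac1 mul1r.
Qed.

Lemma proper_polycf s :
  all nonconstant (unzip2 s) -> proper_fraction (polycf s).
Proof.
elim: s => [_|[b p] s IHs /= /andP[p_nc s_nc]]; first exact: proper_fraction0.
by apply: proper_fraction_div; last exact: IHs.
Qed.

Lemma cf_tail_den_neq0 (b : nat -> R) (c : nat -> {poly R}) i n :
    (forall j, nonconstant (c j)) ->
  (c i)%:F + cf_tail (fun j => (b j)%:P%:F) (fun j => (c j)%:F) i.+1 n != 0.
Proof.
move=> c_nc; rewrite -polycf_iota tofracD_proper_neq0 //.
  exact: ltn_size_neq0 (c_nc i).
apply: proper_polycf; rewrite /unzip2 -map_comp all_map.
by apply/allP=> j _; exact: c_nc.
Qed.

Lemma proper_regular_cf a :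
  all nonconstant a -> proper_fraction (regular_cf a).
Proof.
move=> a_nc; rewrite regular_cfE; apply: proper_polycf.
by rewrite /unzip2 -map_comp map_id.
Qed.

Lemma regular_cf_cons_neq0 p a :
  all nonconstant (p :: a) -> regular_cf (p :: a) != 0.
Proof.
case/andP=> p_nc a_nc; rewrite regular_cf_cons invr_eq0.
rewrite tofracD_proper_neq0 ?(ltn_size_neq0 p_nc) //.
exact: proper_regular_cf.
Qed.

Lemma regular_cf_inj a a' :
    all nonconstant a -> all nonconstant a' ->
  regular_cf a = regular_cf a' -> a = a'.
Proof.
elim: a a' => [|p a IHa] [|p' a'] // a_nc a'_nc.
- by move/esym/eqP; rewrite (negbTE (regular_cf_cons_neq0 a'_nc)).
- by move/eqP; rewrite (negbTE (regular_cf_cons_neq0 a_nc)).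
case/andP: a_nc a'_nc => _ a_nc /andP[_ a'_nc].
rewrite !regular_cf_cons => /invr_inj/tofracD_proper_inj.
by case=> [||-> /IHa -> //]; exact: proper_regular_cf.
Qed.

End PolynomialContinuedFractions.

Lemma cf_expansion_inj (f : Qz) a0 a0' a a' :
  cf_expansion f a0 a -> cf_expansion f a0' a' -> a0 = a0' /\ a = a'.
Proof.
case=> /allP a_nc -> [/allP a'_nc /tofracD_proper_inj].
by case=> [||-> /regular_cf_inj -> //]; exact: proper_regular_cf.
Qed.

Section Regularization.

Variable K : fieldType.
Implicit Types (c : K) (s : seq (K * {poly K})).

(* c * (b / (p + x)) = 1 / ((c * b)^-1 * p + (c * b)^-1 * x) *)
Fixpoint regular_quotients c s : seq {poly K} :=
  if s is (b, p) :: s' then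
    (c * b)^-1 *: p :: regular_quotients (c * b)^-1 s'
  else [::].

Lemma size_regular_quotients c s n :
    c != 0 -> 0 \notin unzip1 s ->
    {in unzip2 s, forall p : {poly K}, size p = n} ->
  {in regular_quotients c s, forall p : {poly K}, size p = n}.
Proof.
elim: s c => [//|[b p] s IHs] c c_neq0 /=; rewrite inE negb_or eq_sym.
case/andP=> b_neq0 s_neq0 /forall_cons[size_p size_s].
have cb_neq0 : (c * b)^-1 != 0 by rewrite invr_eq0 mulf_neq0.
by move=> q /predU1P[->|]; [rewrite size_scale | exact: IHs].
Qed.

Lemma regular_cf_quotients c s :
    c != 0 -> 0 \notin unzip1 s ->
  regular_cf (regular_quotients c s) = c%:P%:F * polycf s.
Proof.
elim: s c => [|[b p] s IHs] c c_neq0 /=; first by rewrite mulr0.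
rewrite inE negb_or eq_sym => /andP[b_neq0 s_neq0].
have cb_neq0 : c * b != 0 by rewrite mulf_neq0.
rewrite regular_cf_cons polycf_cons IHs ?invr_eq0 // -mul_polyC tofracM.
have -> : (c * b)^-1%:P%:F = (c%:P%:F * b%:P%:F)^-1.
  by rewrite -tofracM -polyCM; exact: (fmorphV (@tofrac _ \o polyC)).
by rewrite -mulrDr invfM invrK mulrA.
Qed.

End Regularization.

Section EvenPart.

Variables (F : fieldType) (b c u d : nat -> F) (y : F).

Local Notation t := (cf_tail b c).
Local Notation s := (cf_tail u d).

Hypothesis c_odd : forall k, c k.*2.+1 = y.
Hypothesis t_den_neq0 : forall i n, c i + t i.+1 n != 0.
Hypothesis d0E : d 0 = y * c 0 + b 1.
Hypothesis dSE :
  forall k, d k.+1 = y * c k.*2.+2 + b k.*2.+2 + b k.*2.+3.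

Let t_mul_den i n : t i n.+1 * (c i + t i.+1 n) = b i.
Proof. exact: (mulfVK (t_den_neq0 i n)). Qed.

Lemma cf_tail_even_part k n :
    (forall j, (k <= j < k + n)%N -> u j.+1 = - (b j.*2.+1 * b j.*2.+2)) ->
  s k.+1 n = - (t k.*2.+1 n.*2.+1 * t k.*2.+2 n.*2).
Proof.
elim: n k => [|n IHn] k uE; first by rewrite mulr0 oppr0.
have s_den : d k.+1 + s k.+2 n =
    (y + t k.*2.+2 n.*2.+2) * (c k.*2.+2 + t k.*2.+3 n.*2.+1).
  rewrite IHn => [|j jb]; last by apply: uE; lia.
  rewrite dSE -(t_mul_den k.*2.+2 n.*2.+1) -(t_mul_den k.*2.+3 n.*2).
  by rewrite (c_odd k.+1); ring.
rewrite doubleS [LHS]cf_tailS s_den uE; last by lia.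
by rewrite -(c_odd k) mulNr -mulf_div.
Qed.

Lemma cf_even_part n :
    u 0 = b 0 ->
    (forall j, (j.+1 < n)%N -> u j.+1 = - (b j.*2.+1 * b j.*2.+2)) ->
  t 0 n.*2 = y * s 0 n.
Proof.
case: n => [|n] u0E uE; first by rewrite mulr0.
have y_neq0 : y != 0 by have := t_den_neq0 1 0; rewrite (c_odd 0) addr0.
have s_den : d 0 + s 1 n = y * (c 0 + t 1 n.*2.+1).
  rewrite cf_tail_even_part // d0E -(t_mul_den 1 n.*2) (c_odd 0).
  by ring.
by rewrite doubleS !cf_tailS s_den u0E invfM mulrCA mulVKf.
Qed.

End EvenPart.

Lemma v_even l k : v l.+1 k.*2.+2 = - (v l k.+1 / v l.+1 k.*2.+1).
Proof. by have := @vS_even l k.+1 isT; rewrite mul2n doubleS subn1. Qed.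

Lemma v_odd l k : v l.+1 k.*2.+3 = 1 + (-1) ^+ k.+1 - v l.+1 k.*2.+2.
Proof. by have := @vS_odd l k.+1 isT; rewrite mul2n addn1 doubleS. Qed.

Definition v_val (l j : nat) : int :=
  (j == 1)%:Z - (j == 2 ^ l)%N%:Z - (j == (2 ^ l).+1)%:Z.

Lemma v_val_even l k :
  v_val l.+1 k.*2.+2 = v_val l k.+1 - v_val l.+1 k.*2.+1.
Proof. by rewrite /v_val expnS; lia. Qed.

Lemma v_val_odd l k : v_val l.+1 k.*2.+3 = v_val l.+1 k.*2.+2.
Proof. by rewrite /v_val expnS; lia. Qed.

Lemma v_val_le0 l j : (1 < j)%N -> v_val l j <= 0.
Proof. by rewrite /v_val; lia. Qed.

Lemma v_has_padic_val l j :
  (j < 2 ^ l.+1)%N -> has_padic_val 2 (v_val l j) (v l j).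
Proof.
elim: l j => [|l IHl] j; first by case: j => [|[|//]] _; exact: has_padic_val1.
elim: j => [|[|j] IHj] ltj.
- have -> : v_val l.+1 0 = 0 by rewrite /v_val expnS; lia.
  exact: has_padic_val1.
- have -> : v_val l.+1 1 = 1 by rewrite /v_val expnS; lia.
  exact: has_padic_val_base.
have {}IHj := IHj (ltnW ltj).
have [k [jE|jE]] : exists k, j = k.*2 \/ j = k.*2.+1 by exists j./2; lia.
  rewrite jE v_val_even v_even; apply/has_padic_valN/has_padic_val_div => //.
    by apply: IHl; move: ltj; rewrite jE expnS; lia.
  by rewrite -jE.
rewrite jE v_val_odd v_odd.
have -> : 1 + (-1) ^+ k.+1 = (~~ odd k.+1)%:~R * 2%:R :> rat.
  by rewrite -signr_odd; case: odd.
apply: has_padic_valMnDl; [by [] | exact: v_val_le0 |].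
by apply: has_padic_valN; rewrite -jE.
Qed.

Lemma v_neq0 l j : (j < 2 ^ l.+1)%N -> v l j != 0.
Proof. by move/v_has_padic_val/has_padic_val_neq0; exact. Qed.

(* The level l fraction with an arbitrary polynomial p in place of z, so that
   substituting z^2 for z is replacing p by p ^+ 2. *)
Definition v_terms (l : nat) (p : {poly rat}) : seq (rat * {poly rat}) :=
  mkseq (fun j => (v l j, p + (-1) ^+ j)) (2 ^ l.+1).

Lemma v_terms_neq0 l p : 0 \notin unzip1 (v_terms l p).
Proof.
rewrite /unzip1 -map_comp; apply/mapP=> -[j]; rewrite mem_iota => ltj /esym/eqP.
by rewrite (negbTE (v_neq0 ltj)).
Qed.

Lemma size_v_terms l (p : {poly rat}) : nonconstant p ->
  {in unzip2 (v_terms l p), forall q : {poly rat}, size q = size p}.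
Proof.
move=> p_nc q; rewrite /unzip2 -map_comp => /mapP[j _ ->].
exact: size_addr_sign.
Qed.

Lemma polycf_v_terms_succ l (p : {poly rat}) : nonconstant p ->
  polycf (v_terms l.+1 p) = (p - 1)%:F * polycf (v_terms l (p ^+ 2)).
Proof.
move=> p_nc; rewrite !polycf_iota expnS mul2n.
have sign_double k : (-1) ^+ k.*2 = 1 :> {poly rat}.
  by rewrite -signr_odd odd_double.
apply: cf_even_part => [k|i n||k||j ltj].
- by rewrite exprS sign_double mulr1.
- apply: (cf_tail_den_neq0 (v l.+1) i n) => j.
  by rewrite /nonconstant size_addr_sign.
- by rewrite -tofracM -tofracD /= rmorph_nat; congr _%:F; ring.
- rewrite -tofracM -!tofracD v_odd -doubleS sign_double; congr _%:F.
  by rewrite polyCB polyCD polyC_exp polyCN polyC1; ring.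
- by case: (l).
have v_odd_neq0 : v l.+1 j.*2.+1 != 0 by rewrite v_neq0 // expnS; lia.
by rewrite v_even mulrC -tofracM -tofracN -polyCM -polyCN mulNr opprK divfK.
Qed.

Definition g_at (F : fieldType) (l : nat) (x : F) : F :=
  x^-1 * \prod_(h < l.+1) (1 - x ^- (2 ^ h)).

Lemma g_at0 (F : fieldType) (x : F) :
  x != 0 -> x - 1 != 0 -> g_at 0 x = 1 / (x + 1 + 1 / (x - 1)).
Proof.
move=> x_neq0 x1_neq0; rewrite /g_at big_ord1 expn0 expr1.
have -> : x + 1 + 1 / (x - 1) = x ^+ 2 / (x - 1) by field.
by field; rewrite x_neq0 x1_neq0.
Qed.

Lemma g_at_succ (F : fieldType) l (x : F) :
  x != 0 -> g_at l.+1 x = (x - 1) * g_at l (x ^+ 2).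
Proof.
move=> x_neq0; rewrite /g_at big_ord_recl.
under eq_bigr => i _ do rewrite lift0 expnS exprM.
by rewrite !mulrA; congr (_ * _); rewrite expn0 expr1; field.
Qed.

Lemma polycf_v_terms l (p : {poly rat}) :
  nonconstant p -> polycf (v_terms l p) = g_at l p%:F.
Proof.
elim: l p => [|l IHl] p p_nc.
all: have p_neq0 : p%:F != 0 by rewrite tofrac_eq0 (ltn_size_neq0 p_nc).
  have p1_neq0 : p%:F - 1 != 0.
    rewrite -tofrac1 -tofracB tofrac_eq0 -size_poly_gt0.
    by rewrite (size_addr_sign 1) // ltnW.
  rewrite g_at0 // polycf_iota !cf_tailS addr0.
  by rewrite tofracD tofracB !tofrac1.
rewrite polycf_v_terms_succ // g_at_succ // IHl ?nonconstant_exp //.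
by rewrite tofracXn tofracB tofrac1.
Qed.

Lemma denE j : den j = ('X + (-1) ^+ j)%:F.
Proof.
by rewrite /den -signr_odd; case: odd; rewrite ?tofracB ?tofracD tofrac1.
Qed.

Theorem theorem2p2 (l : nat) :
  [/\ (* the recursion defining v^(l) never divides by zero *)
      (forall j : nat, (1 <= j <= 2 ^ l - 1)%N -> v l (2 * j - 1) != 0),
      g l = gencf (mkseq (fun j => (Qz_const (v l j), den j)) (2 ^ l.+1)),
      (exists a : seq {poly rat}, cf_expansion (g l) 0 a)
    & (forall a : seq {poly rat}, cf_expansion (g l) 0 a ->
        forall p, p \in a -> size p = 2%N)].
Proof.
have X_nc : nonconstant ('X : {poly rat}) by rewrite /nonconstant size_polyX.
have gE : g l = polycf (v_terms l 'X) by rewrite polycf_v_terms.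
pose a := regular_quotients 1 (v_terms l 'X).
have size_a : {in a, forall p : {poly rat}, size p = 2%N}.
  apply: size_regular_quotients (oner_neq0 _) (v_terms_neq0 _ _) _.
  by move=> p /(size_v_terms X_nc) ->; exact: size_polyX.
have a_cf : cf_expansion (g l) 0 a.
  split=> [p /size_a -> //|]; rewrite tofrac0 add0r -/(regular_cf a).
  by rewrite regular_cf_quotients ?oner_neq0 ?v_terms_neq0 // tofrac1 mul1r.
split.
- by move=> j jb; apply: v_neq0; rewrite expnS; lia.
- rewrite gE polycf_iota; congr gencf.
  by apply: eq_map => j; rewrite denE.
- by exists a.
- by move=> a' /(cf_expansion_inj a_cf)[_ <-].
Qed.
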